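(* Suppose Assumption (G) holds. Let $(f^n)_n$ in $Y$ and $f^\dagger\in Y$ be such that $f^n\overset{D}{\to}f^\dagger$ as $n\to\infty$, and for $i\in\{1,\dots,N\}$ let $p_i\in[1,\infty)$ and $\delta_i^n=D_i(f_i^\dagger,f_i^n)^{1/p_i}$, so that $\delta_i^n\to0$. Let $I\subset\{1,\dots,N\}$, $I^c=\{1,\dots,N\}\setminus I$, and choose $\lambda^n=(\lambda_1^n,\dots,\lambda_N^n)\in(0,\infty)^N$ such that $$\lambda_i^n\to\infty\ \text{ and }\ \lambda_i^n(\delta_i^n)^{p_i}\to0\quad\text{for }i\in I,\qquad \lambda_i^n\to\lambda_i^\dagger\in(0,\infty)\quad\text{for }i\in I^c,$$ and denote $\lambda^\dagger=\lim_{n\to\infty}\lambda^n\in(0,\infty]^N$. Assume that there exists a $J_{\lambda^\dagger,I^c}$-minimal solution $u_0$ to $T_Iu=f_I^\dagger$ such that condition $S_1(u_0,f^\dagger,I^c)$ holds. Then every sequence $(u^n)_n$ of solutions to the problems $$\min_{u\in\operatorname{dom}(T)}J_{\lambda^n}(u,f^n)$$ admits a $\tau_X$-convergent subsequence, again denoted by $(u^n)_n$, with limit $u^\dagger$ such that $$D_i(T_iu^n,f_i^n)=o((\lambda_i^n)^{-1})\quad\text{for }i\in I,$$ $$\lim_{n\to\infty}D_i(T_iu^n,f_i^n)=D_i(T_iu^\dagger,f_i^\dagger)\quad\text{for }i\in I^c,$$ $$\lim_{n\to\infty}R(u^n)=R(u^\dagger),$$ and every limit of a $\tau_X$-convergent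 subsequence of solutions is a solution to $$\min_{\substack{u\in\operatorname{dom}(T)\\ T_Iu=f_I^\dagger}}J_{\lambda^\dagger}(u,f^\dagger).$$
   Context: Setting. Let $(X,\|\cdot\|_X)$ be a Banach space and $R\colon X\to[0,\infty]$. For $i=1,\dots,N$ let $(Y_i,\|\cdot\|_{Y_i})$ be a normed space, $D_i\colon Y_i\times Y_i\to[0,\infty]$ a data discrepancy and $T_i\colon \operatorname{dom}(T_i)\subset X\to Y_i$ an operator. Put $\operatorname{dom}(T)=\bigcap_{i=1}^N\operatorname{dom}(T_i)$ and $Y=Y_1\times\cdots\times Y_N$. For $u\in\operatorname{dom}(T)$, $f\in Y$ and $\lambda\in[0,\infty]^N$ let $$J_\lambda(u,f)=\sum_{i=1}^N\lambda_iD_i(T_iu,f_i)+R(u),$$ where for $\lambda_i=\infty$ the term $\lambda_iD_i(T_iu,f_i)$ is $0$ if $D_i(T_iu,f_i)=0$ and $\infty$ otherwise. For $I\subset\{1,\dots,N\}$ put $J_{\lambda,I^c}(u,f)=R(u)+\sum_{i\in I^c}\lambda_iD_i(T_iu,f_i)$; $T_Iu=f_I^\dagger$ means $T_iu=f_i^\dagger$ for all $i\in I$. A $J_{\lambda^\dagger,I^c}$-minimal solution to $T_Iu=f_I^\dagger$ is a minimizer of $J_{\lambda^\dagger,I^c}(\cdot,f^\dagger)$ over $\{u\in\operatorname{dom}(T): T_Iu=f_I^\dagger\}$ at which this functional is finite. Let $\tau_X$ be a Hausdorff topology on $X$, and for each $i$ let $\tau_{Y_i}$ (Hausdorff) and $\tau_{D_i}$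 (arbitrary) be topologies on $Y_i$. Write $f_i^n\overset{D_i}{\to}f_i$ if $D_i(f_i,f_i^n)\to0$ and $f_i^n\to f_i$ in $\tau_{D_i}$ as $n\to\infty$; $f^n\overset{D}{\to}f$ means this holds for every component. Assumption (G): (1) For each $i$ and $a,b\in Y_i$, $D_i(a,b)=0$ implies $a=b$. (2) For each $i$: if $a^n\to a$ in $\tau_{Y_i}$ and $f_i^n\overset{D_i}{\to}f_i$, then $D_i(a,f_i)\le\liminf_{n\to\infty}D_i(a^n,f_i^n)$. (3) $R$ is lower semi-continuous w.r.t. $\tau_X$. (4) Each $T_i$ is continuous from $(X,\tau_X)$ (on $\operatorname{dom}(T_i)$) to $(Y_i,\tau_{Y_i})$ and $\operatorname{dom}(T_i)$ is closed w.r.t. convergence in $\tau_X$. (5) For any $\lambda\in(0,\infty)^N$: whenever $f^n\overset{D}{\to}f$ and $J_\lambda(u^n,f^n)<c$ for all $n$ and some constant $c$, the sequence $(u^n)_n$ admits a $\tau_X$-convergent subsequence. Condition $S_1(u,f^\dagger,I^c)$: for each $i\in I^c$ the map $f_i\mapsto D_i(T_iu,f_i)$ is continuous at $f_i^\dagger$ w.r.t. $D_i$-convergence, i.e. $f_i^n\overset{D_i}{\to}f_i^\dagger$ implies $D_i(T_iu,f_i^n)\to D_i(T_iu,f_i^\dagger)$. Notation: $x^n=o(y^n)$ means $x^n/y^n\to0$. *)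

(* Defs.v *)
From HB Require Import structures.
From mathcomp Require Import all_boot all_order all_algebra.
From mathcomp Require Import all_classical all_reals all_analysis.

Set Implicit Arguments.
Unset Strict Implicit.
Unset Printing Implicit Defensive.

Import Order.TTheory GRing.Theory Num.Theory.
Import numFieldNormedType.Exports.

Local Open Scope classical_set_scope.
Local Open Scope ring_scope.
Local Open Scope ereal_scope.

(* A topology as a piece of data on T. Normed spaces already carry their norm
   topology, so a further topology tau on T is accessed through the type
   [topo tau], which is a copy of T with tau as its canonical topology. *)
Record topology (T : Type) : Type := Topology {
  topology_open : set_system T;
  topology_openT : topology_open setT;
  topology_openI : setI_closed topology_open;
  topology_open_bigU : forall (I : Type) (F : I -> set T),
    (forall i, topology_open (F i)) -> topology_open (\bigcup_i F i) }.

Definition topo (T : choiceType) (tau : topology T) : Type := T.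

HB.instance Definition _ (T : choiceType) (tau : topology T) :=
  Choice.on (topo tau).
HB.instance Definition _ (T : choiceType) (tau : topology T) :=
  @isOpenTopological.Build (topo tau) (topology_open tau)
    (topology_openT tau) (@topology_openI _ tau) (@topology_open_bigU _ tau).

Definition tcvg (T : choiceType) (tau : topology T) (u : nat -> T) (l : T) :
    Prop :=
  (u : nat -> topo tau) @ \oo --> (l : topo tau).

Definition minimizes (T : Type) (R : realType) (A : set T) (F : T -> \bar R)
    (u : T) : Prop :=
  A u /\ forall v, A v -> F u <= F v.

(* x^n = o(y^n) *)
Definition seq_littleo (R : realType) (x : nat -> \bar R) (y : nat -> R) :
    Prop :=
  x n / (y n)%:E @[n --> \oo] --> 0.

(* The operator T i : dom(T i) -> Y i is represented by a total function on X,
   together with the set domT i; its values outside domT i are never used. *)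
Definition dom (N : nat) (X : Type) (domT : 'I_N -> set X) : set X :=
  [set u | forall i, domT i u].

Definition feasible (N : nat) (X : Type) (Y : 'I_N -> Type)
    (domT : 'I_N -> set X) (T : forall i, X -> Y i) (I : {set 'I_N})
    (g : forall i, Y i) : set X :=
  [set u | dom domT u /\ forall i, i \in I -> T i u = g i].

(* For nonnegative d the product +oo * d of \bar R is 0 if d = 0 and +oo
   otherwise. *)
Definition J (N : nat) (R : realType) (X : Type) (Y : 'I_N -> Type)
    (D : forall i, Y i -> Y i -> \bar R) (T : forall i, X -> Y i)
    (Reg : X -> \bar R) (lam : 'I_N -> \bar R) (u : X) (f : forall i, Y i) :
    \bar R :=
  \sum_(i < N) lam i * D i (T i u) (f i) + Reg u.

Definition Jrestr (N : nat) (R : realType) (X : Type) (Y : 'I_N -> Type)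
    (D : forall i, Y i -> Y i -> \bar R) (T : forall i, X -> Y i)
    (Reg : X -> \bar R) (lam : 'I_N -> \bar R) (K : {set 'I_N}) (u : X)
    (f : forall i, Y i) : \bar R :=
  Reg u + \sum_(i in K) lam i * D i (T i u) (f i).

Definition minimal_solution (N : nat) (R : realType) (X : Type)
    (Y : 'I_N -> Type) (D : forall i, Y i -> Y i -> \bar R)
    (domT : 'I_N -> set X) (T : forall i, X -> Y i) (Reg : X -> \bar R)
    (lam : 'I_N -> \bar R) (I : {set 'I_N}) (f : forall i, Y i) (u : X) :
    Prop :=
  minimizes (feasible domT T I f) (fun v => Jrestr D T Reg lam (~: I) v f) u /\
  Jrestr D T Reg lam (~: I) u f \is a fin_num.

Definition Dcvg (R : realType) (Y : choiceType) (D : Y -> Y -> \bar R)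
    (tauD : topology Y) (fn : nat -> Y) (f : Y) : Prop :=
  D f (fn n) @[n --> \oo] --> 0 /\ tcvg tauD fn f.

Record assumptionG (N : nat) (R : realType) (X : choiceType)
    (Y : 'I_N -> choiceType) (D : forall i, Y i -> Y i -> \bar R)
    (domT : 'I_N -> set X) (T : forall i, X -> Y i) (Reg : X -> \bar R)
    (tauX : topology X) (tauY tauD : forall i, topology (Y i)) : Prop := {
  G_definite : forall i (a b : Y i), D i a b = 0 -> a = b;
  G_liminf : forall i (an : nat -> Y i) (a : Y i) (fn : nat -> Y i) (f : Y i),
    tcvg (tauY i) an a -> Dcvg (D i) (tauD i) fn f ->
    D i a f <= limn_einf (fun n => D i (an n) (fn n));
  G_lsc : lower_semicontinuous (Reg : topo tauX -> \bar R);
  G_continuous : forall i,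
    {within (domT i : set (topo tauX)),
      continuous (T i : topo tauX -> topo (tauY i))};
  G_closed : forall i (un : nat -> X) (u : X),
    (forall n, domT i (un n)) -> tcvg tauX un u -> domT i u;
  G_compact : forall (lam : 'I_N -> R), (forall i, (0 < lam i)%R) ->
    forall (fn : nat -> forall i, Y i) (f : forall i, Y i) (un : nat -> X)
      (c : R),
    (forall i, Dcvg (D i) (tauD i) (fun n => fn n i) (f i)) ->
    (forall n, dom domT (un n)) ->
    (forall n, J D T Reg (EFin \o lam) (un n) (fn n) < c%:E) ->
    exists2 phi : nat -> nat, increasing_seq phi &
      exists u : X, tcvg tauX (un \o phi) u }.

Definition S1 (N : nat) (R : realType) (X : Type) (Y : 'I_N -> choiceType)
    (D : forall i, Y i -> Y i -> \bar R) (T : forall i, X -> Y i)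
    (tauD : forall i, topology (Y i)) (u : X) (f : forall i, Y i)
    (K : {set 'I_N}) : Prop :=
  forall i, i \in K -> forall fn : nat -> Y i,
    Dcvg (D i) (tauD i) fn (f i) ->
    D i (T i u) (fn n) @[n --> \oo] --> D i (T i u) (f i).

(* Main.v *)
Require Import Defs.
From mathcomp Require Import all_boot all_order all_algebra.
From mathcomp Require Import all_classical all_reals all_analysis.
From mathcomp Require Import lra.
Import Order.TTheory GRing.Theory Num.Theory.
Import numFieldNormedType.Exports.

Local Open Scope classical_set_scope.
Local Open Scope ring_scope.
Local Open Scope ereal_scope.

(** The functional J_lamdag(., fdag), in which the value +oo of lamdag i for i
    in I acts as the constraint T_i u = fdag_i, is a variational limit of the
    functionals J_(lam n)(., f n), and the theorem is the usual stability of
    minimizers under such a limit.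

    Lower bound: if minimizers u_n converge to v along a subsequence, then each
    summand of J_(lam n)(u_n, f n) has a lower limit at least the corresponding
    summand of J_lamdag(v, fdag) ([liminf_geM] with [liminf_ge_discrepancy],
    and [liminf_ge_regularizer]).  The weights tending to +oo are covered
    uniformly with the others, because 0 times +oo is 0.

    Recovery: the constant sequence u0 is enough, J_(lam n)(u0, f n) tends to
    J_lamdag(u0, fdag) ([cvg_J]).  The summands in I vanish in the limit by the
    parameter choice lam * delta ^ p --> 0, the others converge by S1.

    Since u_n does at least as well as u0, J_lamdag(v, fdag) is at most the
    finite number J_lamdag(u0, fdag).  A finite value forces v to be feasible
    ([finite_J_feasible]), and on feasible points J_lamdag is the restricted
    functional minimized by u0 ([J_feasible]), so v is a minimizer and equality
    holds.  With equality no summand has room to exceed its lower bound: each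
    one converges to the corresponding summand at v ([liminf_geD_cvg]).  For i
    in I this says lam * D --> 0, which is the little-o claim; for i outside I
    one divides by the convergent weight ([cvge_divr]).  Compactness only needs
    fixed positive weights below a tail of lam ([minimizers_precompact]). *)

(** * Lower limits of extended real sequences *)

(** Equivalent to l <= limn_einf x.  The levels a are real, so sums and products
    of such bounds are handled by choosing real levels below each factor, and
    lower semicontinuity yields the bound directly. *)
Definition liminf_ge {R : realType} (x : nat -> \bar R) (l : \bar R) : Prop :=
  forall a : R, a%:E < l -> \forall n \near \oo, a%:E < x n.

Lemma ereal_between {R : realType} {a : R} {l : \bar R} :
  a%:E < l -> exists2 b : R, (a < b)%R & b%:E < l.
Proof.
case: l => [l||//] al.
- rewrite lte_fin in al; exists ((a + l) / 2)%R; rewrite ?lte_fin; lra.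
- by exists (a + 1)%R; rewrite ?ltry//; lra.
Qed.

Lemma le_limn_einf {R : realType} (x : nat -> \bar R) (l : \bar R) :
  l <= limn_einf x -> liminf_ge x l.
Proof.
rewrite limn_einf_lim (cvg_lim _ (@cvg_einfs_sup _ x))// => lx a al.
have /ereal_sup_gt[_ [n _ <-] an] := lt_le_trans al lx.
exists n => // k /= nk; apply: lt_le_trans an _.
by apply: ereal_inf_lbound; exists k.
Qed.

Lemma liminf_ge0 {R : realType} (x : nat -> \bar R) :
  (forall n, 0 <= x n) -> liminf_ge x 0.
Proof. by move=> x0 a a0; apply: nearW => n; exact: lt_le_trans a0 (x0 n). Qed.

Lemma liminf_geD {R : realType} (x y : nat -> \bar R) (l m : \bar R) :
  0 <= l -> 0 <= m -> liminf_ge x l -> liminf_ge y m ->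
  liminf_ge (fun n => x n + y n) (l + m).
Proof.
move=> l0 m0 xl ym c clm.
have [a [b [al bm cab]]] : exists a b : R,
    [/\ a%:E < l, b%:E < m & (c = a + b)%R].
  case: l m l0 m0 clm {xl ym} => [l||//] [m||//] _ _; rewrite ?lte_fin => clm.
  - by exists ((c + l - m) / 2)%R, ((c - l + m) / 2)%R; rewrite !lte_fin;
      split; lra.
  - by exists (l - 1)%R, (c - l + 1)%R; rewrite lte_fin ltry; split=> //; lra.
  - by exists (c - m + 1)%R, (m - 1)%R; rewrite lte_fin ltry; split=> //; lra.
  - by exists c, 0%R; rewrite !ltry addr0.
near=> n; rewrite cab EFinD; apply: lteD.
- by near: n; exact: xl.
- by near: n; exact: ym.
Unshelve. all: by end_near. Qed.

Lemma liminf_ge_sum {R : realType} {K : Type} (r : seq K) (P : pred K)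
  (x : nat -> K -> \bar R) (l : K -> \bar R) :
  (forall k, 0 <= l k) -> (forall k, liminf_ge (x ^~ k) (l k)) ->
  liminf_ge (fun n => \sum_(k <- r | P k) x n k) (\sum_(k <- r | P k) l k).
Proof.
move=> l0 xl; elim: r => [|k r IH].
  under [X in liminf_ge X _]eq_fun do rewrite big_nil.
  by rewrite big_nil; exact: liminf_ge0.
under [X in liminf_ge X _]eq_fun do rewrite big_cons.
rewrite big_cons; case: ifP => _ //; apply: liminf_geD => //.
exact: sume_ge0.
Qed.

(** Allowing C = +oo treats bounded weights and penalties in one statement: when
    l = 0 the product C * l is 0 and nonnegativity suffices, and when l > 0 a
    real b in ]0, l[ can be chosen so close to l that C * b is still above the
    prescribed level. *)
Lemma liminf_geM {R : realType} (c : nat -> R) (C : \bar R)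
  (x : nat -> \bar R) (l : \bar R) :
  (forall n, 0 < c n)%R -> (c n)%:E @[n --> \oo] --> C -> 0 < C ->
  (forall n, 0 <= x n) -> 0 <= l -> liminf_ge x l ->
  liminf_ge (fun n => (c n)%:E * x n) (C * l).
Proof.
move=> c0 cC C0 x0 l0 xl a.
have [->|ln0] := eqVneq l 0.
  by rewrite mule0; apply: liminf_ge0 => n; rewrite mule_ge0// lee_fin ltW.
have {}l0 : 0 < l by rewrite lt0e ln0.
move=> aCl.
have [b [b0 bl aCb]] : exists b : R, [/\ (0 < b)%R, b%:E < l & a%:E < C * b%:E].
  case: C C0 aCl {cC} => [C||//]; last first.
    move=> _ _; have [b b0 bl] := ereal_between (a := 0%R) l0.
    by exists b; rewrite gt0_mulye ?ltry ?lte_fin.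
  rewrite lte_fin => C0 aCl.
  have [b] : exists2 b : R, (Num.max (a / C) 0 < b)%R & b%:E < l.
    apply: ereal_between; case: l l0 aCl {ln0 xl} => [l||//]; last first.
      by move=> _ _; rewrite ltry.
    rewrite -EFinM !lte_fin => l0 aCl.
    by rewrite gt_max l0 andbT ltr_pdivrMr// mulrC.
  rewrite gt_max => /andP[ab b0] bl; exists b; split=> //.
  by rewrite -EFinM lte_fin mulrC -ltr_pdivrMr.
have cCb : (c n)%:E * b%:E @[n --> \oo] --> C * b%:E.
  apply: cvgeM => //; last exact: cvg_cst.
  by apply: neq0_mule_def; rewrite gt_eqF// mule_gt0.
near=> n; apply: (@lt_trans _ _ ((c n)%:E * b%:E)).
  by near: n; exact: (cCb _ (open_ereal_gt' aCb)).
rewrite lte_pmul2l// ?lte_fin//.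
by near: n; exact: xl.
Unshelve. all: by end_near. Qed.

Lemma liminf_ge_le {R : realType} {x s : nat -> \bar R} {l : \bar R} {m : R} :
  liminf_ge x l -> (forall n, x n <= s n) -> s n @[n --> \oo] --> m%:E ->
  l <= m%:E.
Proof.
move=> xl xs sm; rewrite leNgt; apply/negP => /ereal_between[b mb bl].
suff : b%:E <= m%:E by rewrite lee_fin leNgt mb.
apply: cvge_ge sm; near=> n; apply: le_trans (xs n); apply: ltW.
by near: n; exact: xl.
Unshelve. all: by end_near. Qed.

(** If the upper bound s of x + y tends to exactly the sum of the lower bounds
    of x and y, neither sequence can stay above its own bound: an excess of x
    would have to be compensated by y falling below m. *)
Lemma liminf_geD_cvg {R : realType} {x y s : nat -> \bar R} {l m : \bar R} :
  l \is a fin_num -> m \is a fin_num -> liminf_ge x l -> liminf_ge y m ->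
  (forall n, x n + y n <= s n) -> s n @[n --> \oo] --> l + m ->
  x n @[n --> \oo] --> l.
Proof.
case: l m => [l||] [m||] // _ _ xl ym xys slm.
(* An e/2 of slack in each of x, y and s leaves x within e of its bound, and
     rules out infinite values of x. *)
have close (e : R) : (0 < e)%R ->
    \forall n \near \oo, x n \is a fin_num /\ (`|l - fine (x n)| < e)%R.
  move=> e0; near=> n.
  have : (l - e / 2)%:E < x n.
    by near: n; apply: xl; rewrite lte_fin; lra.
  have : (m - e / 2)%:E < y n.
    by near: n; apply: ym; rewrite lte_fin; lra.
  have : s n < (l + m + e / 2)%:E.
    by near: n; apply: (slm _ (open_ereal_lt' _)); rewrite lte_fin; lra.
  move=> /(le_lt_trans (xys n)).
  case: (x n) (y n) => [a||] [b||] //=; rewrite !lte_fin => ? ? ?; split => //.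
  by rewrite ltr_norml; apply/andP; split; lra.
apply/fine_cvgP; split.
  by apply: filterS (close 1%R _) => // n [].
by apply/cvgrPdist_lt => e /close; apply: filterS => n [].
Unshelve. all: by end_near. Qed.

Lemma increasing_cvgn {phi : nat -> nat} :
  increasing_seq phi -> phi n @[n --> \oo] --> \oo.
Proof.
move=> phi_incr.
have le_phi n : (n <= phi n)%N.
  elim: n => // n; move/leq_ltn_trans; apply.
  by rewrite ltnNge -leEnat phi_incr ltnn.
move=> A [M _ MA]; exists M => // n /= Mn.
by apply: MA => /=; exact: leq_trans Mn (le_phi n).
Qed.

Lemma Dcvg_subseq {R : realType} {Y : choiceType} {D : Y -> Y -> \bar R}
  {tauD : topology Y} {g : nat -> Y} {y : Y} {phi : nat -> nat} :
  phi n @[n --> \oo] --> \oo -> Dcvg D tauD g y -> Dcvg D tauD (g \o phi) y.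
Proof.
move=> phioo [Dg tg]; split.
- exact: (cvg_comp _ (fun n => D y (g n)) phioo Dg).
- exact: (cvg_comp phi (g : nat -> topo tauD) phioo tg).
Qed.

Lemma cvge_divr {R : realType} {c : nat -> R} {C : \bar R}
  {x : nat -> \bar R} {l : \bar R} :
  (forall n, 0 < c n)%R -> (c n)%:E @[n --> \oo] --> C -> 0 < C < +oo ->
  (c n)%:E * x n @[n --> \oo] --> C * l -> C * l \is a fin_num ->
  x n @[n --> \oo] --> l.
Proof.
case: C => [C||//]; last by rewrite ltxx andbF.
rewrite lte_fin => c0 cC /andP[C0 _] cxCl Clfin.
have cVC : ((c n)^-1)%:E @[n --> \oo] --> (C^-1)%:E.
  apply: cvg_EFin; first exact: nearW.
  apply: cvgV; first by rewrite gt_eqF.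
  by have /fine_cvgP[] := cC.
rewrite (_ : l = (C^-1)%:E * (C%:E * l)); last first.
  by rewrite muleA -EFinM mulVf ?mul1e// gt_eqF.
rewrite (_ : x = fun n => ((c n)^-1)%:E * ((c n)%:E * x n)); last first.
  by apply/funext => n; rewrite muleA -EFinM mulVf ?mul1e// gt_eqF.
by apply: cvgeM => //; exact: mule_def_fin.
Qed.

(** * The functional along convergent sequences *)

(** Assumption (G) gives D_i(a, b) = 0 -> a = b but not the converse; that
    D_i(y, y) vanishes at a limit y of data follows from the lower limit
    inequality along the constant sequence y. *)
Lemma Dcvg_self {R : realType} {N : nat} {X : choiceType}
  {Y : 'I_N -> choiceType} {D : forall i, Y i -> Y i -> \bar R}
  {domT : 'I_N -> set X} {T : forall i, X -> Y i} {Reg : X -> \bar R}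
  {tauX : topology X} {tauY tauD : forall i, topology (Y i)}
  (D_ge0 : forall i a b, 0 <= D i a b)
  (hG : assumptionG D domT T Reg tauX tauY tauD)
  {i : 'I_N} {g : nat -> Y i} {y : Y i} :
  Dcvg (D i) (tauD i) g y -> D i y y = 0.
Proof.
move=> gy; apply/eqP; rewrite eq_le D_ge0 andbT.
apply: (@liminf_ge_le _ (fun n => D i y (g n)) (fun n => D i y (g n))) => //.
  apply/le_limn_einf/(G_liminf hG) => //.
  exact: (@cvg_cst (topo (tauY i))).
by case: gy.
Qed.

Lemma liminf_ge_discrepancy {R : realType} {N : nat} {X : choiceType}
  {Y : 'I_N -> choiceType} {D : forall i, Y i -> Y i -> \bar R}
  {domT : 'I_N -> set X} {T : forall i, X -> Y i} {Reg : X -> \bar R}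
  {tauX : topology X} {tauY tauD : forall i, topology (Y i)}
  (hG : assumptionG D domT T Reg tauX tauY tauD)
  {i : 'I_N} {g : nat -> Y i} {y : Y i} {u : nat -> X} {v : X} :
  Dcvg (D i) (tauD i) g y -> (forall n, domT i (u n)) -> tcvg tauX u v ->
  liminf_ge (fun n => D i (T i (u n)) (g n)) (D i (T i v) y).
Proof.
move=> gy domu uv; apply/le_limn_einf/(G_liminf hG) => //.
have domv : domT i v := G_closed hG domu uv.
have /subspace_continuousP/(_ v domv) Tv := G_continuous hG (i := i).
move=> A /Tv; rewrite /= !nbhs_simpl /within /= => TA.
have uA : \forall n \near \oo, domT i (u n) -> A (T i (u n)) := uv _ TA.
by apply: filterS uA => n; exact.
Qed.

Lemma liminf_ge_regularizer {R : realType} {X : choiceType} {Reg : X -> \bar R}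
  {tauX : topology X} {u : nat -> X} {v : X} :
  lower_semicontinuous (Reg : topo tauX -> \bar R) -> tcvg tauX u v ->
  liminf_ge (Reg \o u) (Reg v).
Proof.
move=> lsc uv a /(lsc v)[V nV VReg].
have uV : \forall n \near \oo, V (u n) := uv _ nV.
by apply: filterS uV => n; exact: VReg.
Qed.

(** On feasible points the summands in I are lam_i * D_i(g_i, g_i) = 0, even
    when lam_i = +oo. *)
Lemma J_feasible {R : realType} {N : nat} {X : Type} {Y : 'I_N -> Type}
  (D : forall i, Y i -> Y i -> \bar R) {domT : 'I_N -> set X}
  {T : forall i, X -> Y i} (Reg : X -> \bar R) (lam : 'I_N -> \bar R)
  {I : {set 'I_N}} {g : forall i, Y i} {w : X} :
  (forall i, i \in I -> D i (g i) (g i) = 0) ->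
  feasible domT T I g w -> J D T Reg lam w g = Jrestr D T Reg lam (~: I) w g.
Proof.
move=> Dgg [_ Tw]; rewrite /J /Jrestr addeC; congr (_ + _).
rewrite (bigID (fun i => i \in I)) /= big1 ?add0e.
  by apply: eq_bigl => i; rewrite inE.
by move=> i iI; rewrite Tw// Dgg// mule0.
Qed.

Lemma J_summands_fin_num {R : realType} {N : nat} {X : Type}
  {Y : 'I_N -> Type} {D : forall i, Y i -> Y i -> \bar R}
  {T : forall i, X -> Y i} {Reg : X -> \bar R} {lam : 'I_N -> \bar R}
  {w : X} {g : forall i, Y i} :
  (forall i a b, 0 <= D i a b) -> (forall x, 0 <= Reg x) ->
  (forall i, 0 <= lam i) -> J D T Reg lam w g < +oo ->
  (forall i, lam i * D i (T i w) (g i) \is a fin_num) /\ Reg w \is a fin_num.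
Proof.
move=> D0 Reg0 lam0 Jfin.
have term0 i : 0 <= lam i * D i (T i w) (g i) by exact: mule_ge0.
split=> [i|]; rewrite ge0_fin_numE//; apply: le_lt_trans Jfin.
- rewrite /J (bigD1 i)//= -addeA leeDl// adde_ge0//.
  exact: sume_ge0.
- by rewrite /J leeDr// sume_ge0.
Qed.

(** An infinite weight is a hard constraint: lam_i = +oo makes the i-th summand
    +oo unless the discrepancy is 0. *)
Lemma finite_J_feasible {R : realType} {N : nat} {X : Type} {Y : 'I_N -> Type}
  {D : forall i, Y i -> Y i -> \bar R} {domT : 'I_N -> set X}
  {T : forall i, X -> Y i} {Reg : X -> \bar R} {lam : 'I_N -> \bar R}
  {I : {set 'I_N}} {g : forall i, Y i} {w : X} :
  (forall i a b, 0 <= D i a b) -> (forall i a b, D i a b = 0 -> a = b) ->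
  (forall x, 0 <= Reg x) -> (forall i, 0 <= lam i) ->
  (forall i, i \in I -> lam i = +oo) ->
  dom domT w -> J D T Reg lam w g < +oo -> feasible domT T I g w.
Proof.
move=> D0 D_def Reg0 lam0 lamI domw Jfin; split=> // i iI.
have [/(_ i)+ _] := J_summands_fin_num D0 Reg0 lam0 Jfin.
rewrite lamI// => DT; apply: D_def; apply/eqP/contraT => Dn0.
by move: DT; rewrite gt0_mulye// lt0e Dn0 D0.
Qed.

Lemma cvg_J {R : realType} {N : nat} {X : Type} {Y : 'I_N -> Type}
  {D : forall i, Y i -> Y i -> \bar R} {T : forall i, X -> Y i}
  {Reg : X -> \bar R} {lam : nat -> 'I_N -> R} {L : 'I_N -> \bar R}
  {g : nat -> forall i, Y i} {y : forall i, Y i} {w : X} :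
  (forall i a b, 0 <= D i a b) -> (forall x, 0 <= Reg x) ->
  (forall n i, 0 < lam n i)%R ->
  (forall i, (lam n i)%:E * D i (T i w) (g n i) @[n --> \oo]
               --> L i * D i (T i w) (y i)) ->
  J D T Reg (EFin \o lam n) w (g n) @[n --> \oo] --> J D T Reg L w y.
Proof.
move=> D0 Reg0 lam0 tcvg.
have term0 n i : 0 <= (lam n i)%:E * D i (T i w) (g n i).
  by rewrite mule_ge0// lee_fin ltW.
apply: cvgeD; last exact: cvg_cst; last first.
  apply: (@cvg_nnesum _ _ _ _ _ _
    (fun i n => (lam n i)%:E * D i (T i w) (g n i))) => // i _.
  by apply: nearW => n; exact: term0.
apply: ge0_adde_def; rewrite inE ?Reg0//; apply: sume_ge0 => i _.
by apply: cvge_ge (tcvg i); apply: nearW => n; exact: term0.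
Qed.

Lemma le_J {R : realType} {N : nat} {X : Type} {Y : 'I_N -> Type}
  {D : forall i, Y i -> Y i -> \bar R} {T : forall i, X -> Y i}
  {Reg : X -> \bar R} {lam mu : 'I_N -> \bar R} {w : X} {g : forall i, Y i} :
  (forall i a b, 0 <= D i a b) -> (forall i, mu i <= lam i) ->
  J D T Reg mu w g <= J D T Reg lam w g.
Proof.
move=> D0 mulam; apply: leeD => //; apply: lee_sum => i _.
exact: lee_wpmul2r.
Qed.

(** * Compactness and stability of minimizers *)

(** Coercivity is available for fixed weights only; this produces fixed weights
    that lie below the varying ones, so that a bound for J with weights lam n
    passes to J with weights mu. *)
Lemma positive_lower_bound {R : realType} {N : nat} {lam : nat -> 'I_N -> R}
  {L : 'I_N -> \bar R} :
  (forall i, 0 < L i) -> (forall i, (lam n i)%:E @[n --> \oo] --> L i) ->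
  exists2 mu : 'I_N -> R, (forall i, 0 < mu i)%R &
    \forall n \near \oo, forall i, (mu i <= lam n i)%R.
Proof.
move=> L0 lamL.
have /choice[mu muP] i : exists b : R, (0 < b)%R /\ b%:E < L i.
  by have [b b0 bL] := ereal_between (a := 0%R) (L0 i); exists b.
exists mu => [i|]; first by have [] := muP i.
apply: filter_forall => i; have [_ muL] := muP i.
have lt_mu : \forall n \near \oo, (mu i)%:E < (lam n i)%:E.
  exact: (lamL i _ (open_ereal_gt' muL)).
by apply: filterS lt_mu => n; rewrite lte_fin => /ltW.
Qed.

(** The bounds on J and the comparison of weights hold from some rank on,
    whereas coercivity asks for them at every index; hence the shifted
    sequence. *)
Lemma minimizers_precompact {R : realType} {N : nat} {X : choiceType}
  {Y : 'I_N -> choiceType} {D : forall i, Y i -> Y i -> \bar R}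
  {domT : 'I_N -> set X} {T : forall i, X -> Y i} {Reg : X -> \bar R}
  {tauX : topology X} {tauY tauD : forall i, topology (Y i)}
  (D_ge0 : forall i a b, 0 <= D i a b)
  (hG : assumptionG D domT T Reg tauX tauY tauD)
  {g : nat -> forall i, Y i} {y : forall i, Y i} {lam : nat -> 'I_N -> R}
  {L : 'I_N -> \bar R} {u : nat -> X} {s : nat -> \bar R} {m : R} :
  (forall i, Dcvg (D i) (tauD i) (fun n => g n i) (y i)) ->
  (forall i, 0 < L i) -> (forall i, (lam n i)%:E @[n --> \oo] --> L i) ->
  (forall n, dom domT (u n)) ->
  (forall n, J D T Reg (EFin \o lam n) (u n) (g n) <= s n) ->
  s n @[n --> \oo] --> m%:E ->
  exists2 phi : nat -> nat, increasing_seq phi &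
    exists v : X, tcvg tauX (u \o phi) v.
Proof.
move=> gy L0 lamL domu us sm.
have [mu mu0 [M _ Mmu]] := positive_lower_bound L0 lamL.
have [K _ Ks] : \forall n \near \oo, s n < (m + 1)%:E.
  by apply: (sm _ (open_ereal_lt' _)); rewrite lte_fin ltrDl.
pose shift n := (n + maxn M K)%N.
have shiftoo : shift n @[n --> \oo] --> \oo by exact: cvg_addnr.
have [||n|phi phi_incr [v uv]] := G_compact hG mu0 (fn := g \o shift) (f := y)
    (un := u \o shift) (c := (m + 1)%R).
- by move=> i; exact: (Dcvg_subseq shiftoo (gy i)).
- by move=> n; exact: domu.
- apply: le_lt_trans (Ks (shift n) _); last first.
    by rewrite /= /shift (leq_trans (leq_maxr M K))// leq_addl.
  apply: le_trans (us _); apply: le_J => // i.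
  by rewrite lee_fin Mmu//= /shift (leq_trans (leq_maxl M K))// leq_addl.
- exists (shift \o phi); last by exists v.
  by move=> a b; rewrite -phi_incr /= leEnat leq_add2r.
Qed.

Theorem theorem2p5 (R : realType) (N : nat) (X : completeNormedModType R)
  (Y : 'I_N -> normedModType R)
  (Reg : X -> \bar R) (Reg_ge0 : forall u, 0 <= Reg u)
  (D : forall i, Y i -> Y i -> \bar R) (D_ge0 : forall i a b, 0 <= D i a b)
  (domT : 'I_N -> set X) (T : forall i, X -> Y i)
  (tauX : topology X) (tauX_hausdorff : hausdorff_space (topo tauX))
  (tauY : forall i, topology (Y i))
  (tauY_hausdorff : forall i, hausdorff_space (topo (tauY i)))
  (tauD : forall i, topology (Y i))
  (hG : assumptionG D domT T Reg tauX tauY tauD)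
  (f : nat -> forall i, Y i) (fdag : forall i, Y i)
  (f_cvg : forall i, Dcvg (D i) (tauD i) (fun n => f n i) (fdag i))
  (p : 'I_N -> R) (p_ge1 : forall i, (1 <= p i)%R)
  (delta : nat -> 'I_N -> \bar R)
  (deltaE : forall n i, delta n i = D i (fdag i) (f n i) `^ (p i)^-1)
  (I : {set 'I_N})
  (lam : nat -> 'I_N -> R) (lam_gt0 : forall n i, (0 < lam n i)%R)
  (lamdag : 'I_N -> \bar R)
  (lam_cvg : forall i, (lam n i)%:E @[n --> \oo] --> lamdag i)
  (lamdag_I : forall i, i \in I -> lamdag i = +oo)
  (lam_delta : forall i, i \in I ->
     (lam n i)%:E * delta n i `^ p i @[n --> \oo] --> 0)
  (lamdag_Ic : forall i, i \in ~: I -> 0 < lamdag i < +oo)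
  (u0 : X) (u0_min : minimal_solution D domT T Reg lamdag I fdag u0)
  (u0_S1 : S1 D T tauD u0 fdag (~: I))
  (u : nat -> X)
  (u_min : forall n,
     minimizes (dom domT) (fun v => J D T Reg (EFin \o lam n) v (f n)) (u n)) :
  (exists2 phi : nat -> nat, increasing_seq phi &
     exists udag : X,
       [/\ tcvg tauX (u \o phi) udag,
           forall i, i \in I ->
             seq_littleo (fun n => D i (T i (u (phi n))) (f (phi n) i))
                         (fun n => (lam (phi n) i)^-1)%R,
           forall i, i \in ~: I ->
             D i (T i (u (phi n))) (f (phi n) i) @[n --> \oo]
               --> D i (T i udag) (fdag i) &
           Reg (u (phi n)) @[n --> \oo] --> Reg udag]) /\
  (forall (phi : nat -> nat) (v : X), increasing_seq phi ->
     tcvg tauX (u \o phi) v ->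
     minimizes (feasible domT T I fdag)
       (fun w => J D T Reg lamdag w fdag) v).
Proof.
have D_def := G_definite hG.
have DI i : D i (fdag i) (fdag i) = 0.
  exact: (Dcvg_self D_ge0 hG (f_cvg i)).
have lamdag_gt0 i : 0 < lamdag i.
  have [iI|iIc] := boolP (i \in I); first by rewrite lamdag_I.
  by have /andP[] : 0 < lamdag i < +oo by apply: lamdag_Ic; rewrite inE.
have lamdag_ge0 i : 0 <= lamdag i by exact: ltW.
have [[[domu0 Tu0] u0_le] u0_fin] := u0_min.
have u0_feas : feasible domT T I fdag u0 by [].
set Jdag := fun w => J D T Reg lamdag w fdag.
have JE w : feasible domT T I fdag w ->
    Jdag w = Jrestr D T Reg lamdag (~: I) w fdag.
  by apply: J_feasible => i _; exact: DI.
have u0_le_feas w : feasible domT T I fdag w -> Jdag u0 <= Jdag w.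
  by move=> wI; rewrite !JE//; exact: u0_le.
have [m mE] : exists m : R, Jdag u0 = m%:E.
  by rewrite JE//; exists (fine (Jrestr D T Reg lamdag (~: I) u0 fdag));
    rewrite fineK.
pose s n := J D T Reg (EFin \o lam n) u0 (f n).
(* The constant sequence u0 is a recovery sequence. *)
have s_cvg : s n @[n --> \oo] --> m%:E.
  rewrite -mE; apply: cvg_J => // i.
  have [iI|iIc] := boolP (i \in I).
    rewrite Tu0// DI// mule0; have := lam_delta i iI.
    have p_neq0 : p i != 0%R by rewrite gt_eqF// (lt_le_trans _ (p_ge1 i)).
    by under eq_fun do rewrite deltaE -poweRrM mulVf// poweRe1//.
  have {}iIc : i \in ~: I by rewrite inE.
  apply: cvgeM => //; last exact: u0_S1.
  apply: mule_def_fin.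
    by rewrite ge0_fin_numE ?ltW//; case/andP: (lamdag_Ic i iIc).
  have u0_lty : Jdag u0 < +oo by rewrite mE ltry.
  have [/(_ i)+ _] := J_summands_fin_num D_ge0 Reg_ge0 lamdag_ge0 u0_lty.
  move=> tfin; rewrite ge0_fin_numE// ltey; apply: contraTneq tfin => ->.
  by rewrite gt0_muley.
have us n : J D T Reg (EFin \o lam n) (u n) (f n) <= s n.
  by case: (u_min n) => _; exact.
have domu n : dom domT (u n) by case: (u_min n).
have lim_terms phi v : increasing_seq phi -> tcvg tauX (u \o phi) v ->
    [/\ s (phi n) @[n --> \oo] --> m%:E,
        forall i, liminf_ge (fun n => (lam (phi n) i)%:E *
             D i (T i (u (phi n))) (f (phi n) i))
          (lamdag i * D i (T i v) (fdag i)),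
        liminf_ge (fun n => Reg (u (phi n))) (Reg v),
        feasible domT T I fdag v &
        Jdag v = m%:E].
  move=> /increasing_cvgn phioo uv.
  have s_phi : s (phi n) @[n --> \oo] --> m%:E.
    exact: (cvg_comp phi s phioo s_cvg).
  have lbD i : liminf_ge (fun n => (lam (phi n) i)%:E *
      D i (T i (u (phi n))) (f (phi n) i)) (lamdag i * D i (T i v) (fdag i)).
    apply: liminf_geM => //.
      exact: (cvg_comp phi (fun n => (lam n i)%:E) phioo (lam_cvg i)).
    apply: (liminf_ge_discrepancy hG (u := u \o phi) _ _ uv) => [|n].
      exact: (Dcvg_subseq phioo (f_cvg i)).
    exact: domu.
  have lbR := liminf_ge_regularizer (G_lsc hG) uv.
  have Jv : Jdag v <= m%:E.
    apply: (liminf_ge_le _ _ s_phi); last by move=> n; exact: us.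
    apply: liminf_geD => //.
      by apply: sume_ge0 => i _; rewrite mule_ge0// ltW.
    by apply: liminf_ge_sum => // i; rewrite mule_ge0// ltW.
  have v_feas : feasible domT T I fdag v.
    apply: (finite_J_feasible _ _ Reg_ge0 _ lamdag_I) => //.
    - by move=> i; apply: (G_closed hG _ uv) => n; exact: domu.
    - exact: le_lt_trans Jv (ltry _).
  by split=> //; apply/eqP; rewrite eq_le Jv -mE u0_le_feas.
split; last first.
  move=> phi v phi_incr /(lim_terms _ _ phi_incr)[_ _ _ v_feas Jv].
  by split=> // w wI; rewrite -[leLHS]/(Jdag v) Jv -mE u0_le_feas.
have [phi phi_incr [v uv]] :=
  minimizers_precompact D_ge0 hG f_cvg lamdag_gt0 lam_cvg domu us s_cvg.
exists phi => //; exists v.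
have phioo := increasing_cvgn phi_incr.
have [s_phi lbD lbR v_feas Jv] := lim_terms _ _ phi_incr uv.
(* Since J_lamdag(v, fdag) equals the limit of the upper bounds, each summand
   is squeezed against the sum of all the others. *)
have v_lty : Jdag v < +oo by rewrite Jv ltry.
have [term_fin Reg_fin] := J_summands_fin_num D_ge0 Reg_ge0 lamdag_ge0 v_lty.
have term_ge0 i : 0 <= lamdag i * D i (T i v) (fdag i) by exact: mule_ge0.
have term_cvg i : (lam (phi n) i)%:E * D i (T i (u (phi n))) (f (phi n) i)
    @[n --> \oo] --> lamdag i * D i (T i v) (fdag i).
  pose rest n := \sum_(j < N | j != i)
    (lam (phi n) j)%:E * D j (T j (u (phi n))) (f (phi n) j) + Reg (u (phi n)).
  pose rest_lim :=
    \sum_(j < N | j != i) lamdag j * D j (T j v) (fdag j) + Reg v.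
  apply: (@liminf_geD_cvg _ _ rest (s \o phi) _ rest_lim) => // [||n|].
  - by rewrite fin_numD Reg_fin andbT; apply/sum_fin_numP.
  - by apply: liminf_geD => //; [exact: sume_ge0|exact: liminf_ge_sum].
  - by apply: le_trans (us (phi n)); rewrite /J (bigD1 i)//= -addeA.
  - by move: s_phi; rewrite -Jv /Jdag /J (bigD1 i)//= -addeA.
have Reg_cvg : Reg (u (phi n)) @[n --> \oo] --> Reg v.
  pose fit n := \sum_(j < N)
    (lam (phi n) j)%:E * D j (T j (u (phi n))) (f (phi n) j).
  pose fit_lim := \sum_(j < N) lamdag j * D j (T j v) (fdag j).
  apply: (@liminf_geD_cvg _ _ fit (s \o phi) _ fit_lim) => // [||n|].
  - by apply/sum_fin_numP.
  - exact: liminf_ge_sum.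
  - by apply: le_trans (us (phi n)); rewrite /J addeC.
  - by move: s_phi; rewrite -Jv /Jdag /J addeC.
split=> // i iI.
  rewrite /seq_littleo.
  under eq_fun do rewrite inver invr_eq0 gt_eqF// invrK muleC.
  by have := term_cvg i; rewrite v_feas.2// DI// mule0.
apply: (cvge_divr _ _ (lamdag_Ic i iI) (term_cvg i)) => //.
exact: (cvg_comp phi (fun n => (lam n i)%:E) phioo (lam_cvg i)).
Qed.
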